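(* Let $n\ge1$ and $a=(a_0,\dots,a_n)\in(\mathbb{R}\cup\{\infty\})^{n+1}$ with $a_0,a_n<\infty$. If $a$ is not regular, then $H(a)\ge 1/6$.
   Context: $a$ is regular if the set $J=\{i: a_i<\infty\}$ is an arithmetic progression and each point $(i,a_i)$, $i\in J$, is a vertex of the Newton polygon $P(a)$, which is the convex hull of the vertical rays $\{(i,b): b\ge a_i\}$, $i\in J$. For an integer $s\ge 0$ let $D_s\subset\mathbb{R}^s$ be the set of real vectors $z=(z_1,\dots,z_s)$ such that for every $0\le k\le s-1-n$ the minimum $\min_{0\le i\le n}\{a_i+z_{k+1+i}\}$ is attained for at least two different indices $i$; $D_s$ is a polyhedral complex, $d_s=\dim D_s$, and the tropical entropy is $H(a)=\lim_{s\to\infty}d_s/s$. *)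

(* Defs.v *)
From HB Require Import structures.
From mathcomp Require Import all_boot all_order all_algebra.
From mathcomp Require Import boolp classical_sets reals ereal topology normedtype sequences.

Set Implicit Arguments.
Unset Strict Implicit.
Unset Printing Implicit Defensive.

Import Order.TTheory GRing.Theory Num.Theory.
Local Open Scope ring_scope.
Local Open Scope classical_set_scope.

Section TropicalEntropy.
Variable R : realType.

(* Points of R^s are row vectors 'rV[R]_s; coordinate z_{m+1} (1-based in the
   paper) is [zc z m] (0-based). Out-of-range indices are never used. *)
Definition zc (s : nat) (z : 'rV[R]_s) (m : nat) : R :=
  if (insub m : option 'I_s) is Some j then z ord0 j else 0.

(* a = (a_0, ..., a_n) with entries in R \cup {+oo}: encoded as \bar R with
   the side condition that no entry is -oo (see [entries_ok]). *)
Definition entries_ok (n : nat) (a : 'I_n.+1 -> \bar R) : Prop :=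
  forall i, a i != -oo%E.

Definition finite_support (n : nat) (a : 'I_n.+1 -> \bar R) : set nat :=
  [set i | exists j : 'I_n.+1, val j = i /\ (a j < +oo)%E].

Definition is_arith_prog (J : set nat) : Prop :=
  exists i0 d m : nat, (0 < d)%N /\
    forall i, J i <-> exists2 t : nat, (t <= m)%N & i = (i0 + t * d)%N.

(* Newton polygon: convex hull of the vertical rays {(i,b) : b >= a_i}, i in J.
   Since each ray is convex, the convex hull of their union is the set of
   convex combinations of one point taken from each ray. *)
Definition newton_polygon (n : nat) (a : 'I_n.+1 -> \bar R) : set (R * R) :=
  [set p | exists (lam : 'I_n.+1 -> R) (b : 'I_n.+1 -> R),
     (forall i, 0 <= lam i) /\ \sum_(i < n.+1) lam i = 1 /\
     (forall i, 0 < lam i -> (a i <= (b i)%:E)%E) /\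
     p = (\sum_(i < n.+1) lam i * (val i)%:R, \sum_(i < n.+1) lam i * b i)].

Definition is_vertex (P : set (R * R)) (p : R * R) : Prop :=
  P p /\ forall q r t, P q -> P r -> 0 < t < 1 ->
    p = (t * q.1 + (1 - t) * r.1, t * q.2 + (1 - t) * r.2) -> q = p /\ r = p.

Definition regular (n : nat) (a : 'I_n.+1 -> \bar R) : Prop :=
  is_arith_prog (finite_support a) /\
  forall (i : 'I_n.+1) (ai : R), a i = ai%:E ->
    is_vertex (newton_polygon a) ((val i)%:R, ai).

Definition Dset (n : nat) (a : 'I_n.+1 -> \bar R) (s : nat) : set 'rV[R]_s :=
  [set z | forall k : nat, (k + n < s)%N ->
     exists i j : 'I_n.+1, i != j /\
       (a i + (zc z (k + i))%:E = a j + (zc z (k + j))%:E)%E /\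
       forall l : 'I_n.+1,
         (a i + (zc z (k + i))%:E <= a l + (zc z (k + l))%:E)%E].

(* D contains a relatively open piece of a k-dimensional affine subspace:
   a point z, k linearly independent directions (rows of V), and eps > 0
   such that z + t V lies in D whenever all |t_i| < eps. *)
Definition has_piece (s : nat) (D : set 'rV[R]_s) (k : nat) : Prop :=
  exists (z : 'rV[R]_s) (V : 'M[R]_(k, s)) (eps : R),
    row_free V /\ 0 < eps /\
    forall t : 'rV[R]_k, (forall i, `|t ord0 i| < eps) -> D (z + t *m V).

(* Dimension of a (polyhedral) subset of R^s: the largest k such that it
   contains an open piece of a k-dimensional affine subspace. *)
Definition pdim (s : nat) (D : set 'rV[R]_s) : nat :=
  \max_(k < s.+1 | `[< has_piece D k >]) k.

Definition dseq (n : nat) (a : 'I_n.+1 -> \bar R) (s : nat) : nat :=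
  pdim (@Dset n a s).

End TropicalEntropy.

(* Main.v *)
(** The sequence [d_s] is subadditive (split the coordinates of a flat piece into
    the first [s] and the last [t]), so by Fekete's lemma [d_s / s] tends to its
    infimum, and it suffices to show [s <= 6 d_s] for every [s].

    Subtract a line of slope [beta] from [a] and add one to [z], so that an edge
    of the lower hull of [a], with endpoints [i0 < i2], lies at height [0]; put
    [q = i2 - i0].
    - If a third point [i1] is at height [0], colour the integers with 4 colours
      so that [k + i0], [k + i1], [k + i2] always differ.  Coordinates of one
      colour may be freely positive while all the others are [0]: every window
      still has two zeros.
    - If some finite [a i1] has [i1] not congruent to [i0] modulo [q], take one of
      least height [c].  Colour the residues modulo [q] with 3 colours so that
      those of [k + i0] and [k + i1] always differ, declare one colour high and
      put [z = 0] elsewhere.  A high coordinate is [c] or freely larger than [c],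
      alternately along steps of [q]: in a window where [k + i0] and [k + i2] are
      high, the minimum [c] is attained at [i1] and at one of [i0], [i2].
    If neither happens for any hull edge, the length of each edge divides all the
    gaps in the support, so all edges have one length and [a] is regular. *)

Require Import Defs.
From HB Require Import structures.
From mathcomp Require Import all_boot all_order all_algebra.
From mathcomp Require Import boolp classical_sets reals ereal topology normedtype sequences.
From mathcomp Require Import zify ring lra.
Import numFieldNormedType.Exports.
Import Order.TTheory GRing.Theory Num.Theory.
Local Open Scope ring_scope.
Local Open Scope classical_set_scope.

(** * Dimension and flat pieces *)

Lemma has_piece_le {R : realType} {s : nat} (D : set 'rV[R]_s) (k : nat) :
  has_piece D k -> (k <= s)%N.
Proof. by case=> z [V [eps [/eqP rkV _]]]; rewrite -rkV rank_leq_col. Qed.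

Lemma le_pdim {R : realType} {s : nat} (D : set 'rV[R]_s) (k : nat) :
  has_piece D k -> (k <= pdim D)%N.
Proof.
move=> Dk; have ks : (k < s.+1)%N by rewrite ltnS (has_piece_le _ _ Dk).
by apply: (@bigop.bigmax_sup _ (Ordinal ks)) => //; apply/asboolP.
Qed.

(** The value 0 may come from an empty maximum, since an empty [D] has no piece at all; a positive
    maximum is attained. *)
Lemma pdim_gt0_piece {R : realType} {s : nat} (D : set 'rV[R]_s) :
  (0 < pdim D)%N -> has_piece D (pdim D).
Proof.
rewrite /pdim; apply: (big_ind (fun m => (0 < m)%N -> has_piece D m)) => //.
  by move=> x y Dx Dy; case: (leqP x y).
by move=> i /asboolP.
Qed.

Lemma pdim_le {R : realType} {s : nat} (D : set 'rV[R]_s) : (pdim D <= s)%N.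
Proof. by apply/bigmax_leqP => i _; rewrite -ltnS. Qed.

(** The rows of [V] may be dependent, as happens when a piece is projected. A maximal free subfamily
    of rows is kept, and the parameters of the other rows are set to 0. *)
Lemma rank_piece {R : realType} {s k : nat} (D : set 'rV[R]_s) (z : 'rV[R]_s)
    (V : 'M[R]_(k, s)) (eps : R) :
  0 < eps ->
  (forall t : 'rV[R]_k, (forall i, `|t ord0 i| < eps) -> D (z + t *m V)) ->
  has_piece D (\rank V).
Proof.
move=> e0 DV; exists z, (rowsub (maxrankfun V) V), eps.
split; [exact: maxrowsub_free | split=> // t te].
rewrite rowsubE mulmxA; apply: DV => i; rewrite mxE.
have [[j <-]|nj] := pselect (exists j, maxrankfun V j = i).
  rewrite (bigD1 j) //= big1 ?addr0 => [|l lj]; rewrite !mxE ?eqxx ?mulr1 //.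
  by rewrite (inj_eq (@maxrankfun_inj _ _ _ _)) (negPf lj) mulr0.
rewrite big1 ?normr0 // => j _; rewrite !mxE.
by case: eqP => [ji|]; rewrite ?mulr0 //; case: nj; exists j.
Qed.

Lemma free_coords_pdim {R : realType} {s : nat} (D : set 'rV[R]_s)
    (F : {set 'I_s}) (z0 : 'rV[R]_s) :
  (forall z : 'rV[R]_s, (forall m, m \notin F -> z ord0 m = z0 ord0 m) ->
     (forall m, m \in F -> `|z ord0 m - z0 ord0 m| < 1) -> D z) ->
  (#|F| <= pdim D)%N.
Proof.
move=> DF; apply: le_pdim.
pose V : 'M[R]_(#|F|, s) := \matrix_(i, j) (enum_val i == j)%:R.
exists z0, V, 1; split; last split=> // t te.
  apply/row_freeP; exists V^T; apply/matrixP => i j; rewrite !mxE.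
  rewrite (bigD1 (enum_val i)) //= big1 => [|l li]; rewrite !mxE.
    by rewrite eqxx mul1r addr0 eq_sym (inj_eq enum_val_inj).
  by rewrite eq_sym (negPf li) mul0r.
apply: DF => m mF; rewrite !mxE.
  rewrite big1 ?addr0 // => i _; rewrite mxE.
  by case: eqP => [im|]; rewrite ?mulr0 //; move: mF; rewrite -im enum_valP.
rewrite (bigD1 (enum_rank_in mF m)) //= big1 => [|l li]; rewrite mxE.
  rewrite enum_rankK_in // eqxx mulr1 addr0 addrAC subrr add0r.
  exact: te.
case: eqP => [lm|]; last by rewrite mulr0.
by case/eqP: li; apply: enum_val_inj; rewrite lm enum_rankK_in.
Qed.

Lemma zcE {R : realType} {s : nat} (z : 'rV[R]_s) (m : nat) (ms : (m < s)%N) :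
  zc z m = z ord0 (Ordinal ms).
Proof. by rewrite /zc insubT. Qed.

(** * Subadditivity and Fekete's lemma *)

Lemma Dset_lsubmx {R : realType} {n : nat} (a : 'I_n.+1 -> \bar R) (s t : nat)
    (z : 'rV[R]_(s + t)) :
  Dset a z -> Dset a (lsubmx z).
Proof.
move=> Dz k kns; have [] := Dz k; first by lia.
have E (l : 'I_n.+1) : zc (lsubmx z) (k + l) = zc z (k + l).
  have ls : (k + l < s)%N by have := ltn_ord l; lia.
  rewrite !zcE; first by lia.
  by move=> ls'; rewrite mxE; congr (z _ _); apply: val_inj.
move=> i [j [ij [eqij minij]]]; exists i, j; rewrite !E; split=> //; split=> // l.
by rewrite E.
Qed.

Lemma Dset_rsubmx {R : realType} {n : nat} (a : 'I_n.+1 -> \bar R) (s t : nat)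
    (z : 'rV[R]_(s + t)) :
  Dset a z -> Dset a (rsubmx z).
Proof.
move=> Dz k kns; have [] := Dz (s + k)%N; first by lia.
have E (l : 'I_n.+1) : zc (rsubmx z) (k + l) = zc z (s + k + l).
  have ls : (k + l < t)%N by have := ltn_ord l; lia.
  rewrite !zcE; first by lia.
  by move=> ls'; rewrite mxE; congr (z _ _); apply: val_inj; rewrite /= addnA.
move=> i [j [ij [eqij minij]]]; exists i, j; rewrite !E; split=> //; split=> // l.
by rewrite E.
Qed.

Lemma dseq_subadditive {R : realType} {n : nat} (a : 'I_n.+1 -> \bar R)
    (s t : nat) :
  (dseq a (s + t) <= dseq a s + dseq a t)%N.
Proof.
have [->//|] := posnP (dseq a (s + t)).
rewrite /dseq; move=> /pdim_gt0_piece; move: (pdim (@Dset R n a (s + t))) => k.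
move=> [z [V [eps [/eqP rkV [e0 DV]]]]].
(* After transposition the two column blocks become summands of a row space, and the rank of a sum
   is at most the sum of the ranks. *)
apply: (@leq_trans (\rank (lsubmx V) + \rank (rsubmx V))).
  rewrite -[X in (X <= _)%N]rkV -{1}(hsubmxK V) -mxrank_tr tr_row_mx -addsmxE.
  by rewrite -[X in (_ <= X + _)%N]mxrank_tr -[X in (_ <= _ + X)%N]mxrank_tr
             mxrank_adds_leqif.
apply: leq_add; apply: le_pdim.
- apply: (rank_piece _ (lsubmx z) _ eps e0) => u /DV/Dset_lsubmx.
  by rewrite linearD /= mulmx_lsub.
- apply: (rank_piece _ (rsubmx z) _ eps e0) => u /DV/Dset_rsubmx.
  by rewrite linearD /= mulmx_rsub.
Qed.

(** Division s = q s0 + r with r < s0 gives u s <= q u(s0) + s0, where the last term is negligible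
    against s. *)
Lemma fekete {R : realType} (u : nat -> nat) :
  (forall s t, (u (s + t) <= u s + u t)%N) -> (forall s, (u s <= s)%N) ->
  (fun s : nat => (u s)%:R / s%:R : R) @ \oo -->
    inf [set ((u s)%:R / s%:R : R) | s in [set s | (0 < s)%N]].
Proof.
move=> uD us; set E : set R := (X in inf X); set L := inf E.
have Elb : lbound E 0 by move=> _ [s _ <-]; rewrite divr_ge0.
have E0 : E !=set0 by exists ((u 1)%:R / 1%:R), 1%N.
have Einf : has_inf E by split=> //; exists 0.
have uM s0 q r : (u (q * s0 + r) <= q * u s0 + r)%N.
  elim: q => [|q IHq]; first by rewrite !mul0n !add0n us.
  by rewrite !mulSn -!addnA (leq_trans (uD _ _)) // leq_add2l.
apply/cvgrPdist_lt => e e0; have e20 : 0 < e / 2 by rewrite divr_gt0.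
have [_ [s0 /= s0gt0 <-]] := inf_adherent e20 Einf; rewrite -/L => Ls0.
near=> s.
have s_gt0 : (0 < s)%N by near: s; exists 1%N.
have sR0 : 0 < s%:R :> R by rewrite ltr0n.
have s0R0 : 0 < s0%:R :> R by rewrite ltr0n.
(* For such s the remainder [s0] costs at most s e / 2; the other half of e was spent on the choice
   of [s0]. *)
have es : s0%:R / (e / 2) <= s%:R by near: s; apply: nbhs_infty_ger.
have Ls : L <= (u s)%:R / s%:R by apply: ge_inf; [exists 0 | exists s].
rewrite distrC ger0_norm ?subr_ge0 // ltrBlDl ltr_pdivrMr //.
rewrite ler_pdivrMr // in es.
set x := (u s0)%:R / s0%:R in Ls0.
have ux : (u s)%:R <= s%:R * x + s0%:R.
  have := uM s0 (s %/ s0)%N (s %% s0)%N; rewrite -divn_eq.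
  rewrite -(ler_nat R) natrD natrM => /le_trans; apply; apply: lerD.
    have -> : (u s0)%:R = s0%:R * x :> R by rewrite mulrCA divff ?mulr1 ?gt_eqF.
    rewrite mulrA ler_wpM2r ?divr_ge0 // -natrM ler_nat; exact: leq_trunc_div.
  by rewrite ler_nat ltnW // ltn_mod.
apply: le_lt_trans ux _.
have : s%:R * x < s%:R * (L + e / 2) by rewrite ltr_pM2l.
lra.
Unshelve. all: by end_near. Qed.

(** * Colourings and pigeonhole *)

(** Integers are coloured in increasing order: the list [N m] forbids at most d colours, so one of
    the d + 1 remains. *)
Lemma greedy_coloring (d : nat) (N : nat -> seq nat) :
  (forall m, size (N m) <= d)%N ->
  forall s, exists chi : nat -> 'I_d.+1,
    forall m j, (m < s)%N -> j \in N m -> (j < m)%N -> chi j != chi m.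
Proof.
move=> Nd; elim=> [|s [chi chiP]]; first by exists (fun=> ord0).
have [c cN] : exists c, c \notin [seq chi j | j <- N s].
  apply/existsP; rewrite -[X in is_true X]negbK negb_exists; apply/negP.
  move=> /forallP allN.
  have := @uniq_leq_size _ (enum 'I_d.+1) [seq chi j | j <- N s].
  rewrite enum_uniq -cardE card_ord size_map => /(_ isT) H.
  suff: (d < size (N s))%N by rewrite ltnNge Nd.
  by apply: H => x _; move: (allN x); rewrite negbK.
exists (fun m => if m == s then c else chi m) => m j; rewrite ltnS leq_eqVlt.
have [-> _ jN js|_ /= ms jN jm] := eqVneq m s.
  rewrite (ltn_eqF js); apply: contraNneq cN => <-; exact: map_f.
by rewrite (ltn_eqF (ltn_trans jm ms)) chiP.
Qed.

Lemma largest_fiber {s : nat} {T : finType} (x0 : T) (f : 'I_s -> T) :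
  exists x, (s <= #|T| * #|[set m | f m == x]%SET|)%N.
Proof.
have [x xmax] : exists x, forall y,
    (#|[set m | f m == y]%SET| <= #|[set m | f m == x]%SET|)%N.
  case: (@arg_maxnP _ x0 predT (fun x => #|[set m | f m == x]%SET|) isT).
  by move=> x _ xmax; exists x => y; apply: xmax.
have s_sum : s = (\sum_(y : T) #|[set m | f m == y]%SET|)%N.
  rewrite -[LHS]card_ord -sum1_card (partition_big f predT) //=.
  apply: eq_bigr => y _; rewrite sum1dep_card.
  by apply: eq_card => m; rewrite !inE.
exists x; rewrite [X in (X <= _)%N]s_sum -sum_nat_const.
exact: leq_sum.
Qed.

(** * Levels relative to a supporting line *)

(** As [fine] sends [+oo] to 0, the value is meaningful only for finite [a i]; statements about it
    carry this guard. *)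
Definition height {R : realType} {n : nat} (a : 'I_n.+1 -> \bar R) (beta mu : R)
  (i : 'I_n.+1) : R := fine (a i) - (beta * (val i)%:R + mu).

Definition supports {R : realType} {n : nat} (a : 'I_n.+1 -> \bar R)
    (beta mu : R) : Prop :=
  forall i, (a i < +oo)%E -> 0 <= height a beta mu i.

(** Tilting [z] by [beta] changes the terms of the window at k into [height] plus [y], up to the
    summand mu - beta k, which is the same for the whole window. *)
Lemma in_Dset {R : realType} {n : nat} (a : 'I_n.+1 -> \bar R) (beta mu : R)
    (s : nat) (z : 'rV[R]_s) (y : nat -> R) :
  entries_ok a ->
  (forall m : 'I_s, z ord0 m = y m - beta * (val m)%:R) ->
  (forall k, (k + n < s)%N -> exists i j : 'I_n.+1, exists c : R,
     [/\ i != j, (a i < +oo)%E, (a j < +oo)%E,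
         height a beta mu i + y (k + i)%N = c &
         height a beta mu j + y (k + j)%N = c /\
         forall l, (a l < +oo)%E -> c <= height a beta mu l + y (k + l)%N]) ->
  Dset a z.
Proof.
move=> aok zy Dy k kns; have [i [j [c [ij ai aj ic [jc cmin]]]]] := Dy k kns.
have aE l : (a l < +oo)%E ->
    (a l + (zc z (k + l))%:E =
      (height a beta mu l + y (k + l)%N + (mu - beta * k%:R))%:E)%E.
  move=> al; have ls : (k + l < s)%N by have := ltn_ord l; lia.
  rewrite (zcE _ _ ls) zy /= -[in LHS](@fineK _ (a l)); last first.
    by rewrite fin_numE aok -ltey.
  by rewrite -EFinD /height natrD; congr EFin; ring.
exists i, j; split=> //; rewrite !aE // ic jc; split=> // l.
have [al|] := boolP (a l < +oo)%E; first by rewrite aE // lee_fin lerD2r cmin.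
by rewrite -leNgt leye_eq => /eqP ->; rewrite addye ?leey.
Qed.

Lemma free_levels_dseq {R : realType} {n : nat} (a : 'I_n.+1 -> \bar R)
    (beta mu : R) (s : nat) (y0 : nat -> R) (F : {set 'I_s}) :
  entries_ok a ->
  (forall y : nat -> R,
     (forall m : 'I_s, m \notin F -> y m = y0 m) ->
     (forall m : 'I_s, m \in F -> `|y m - y0 m| < 1) ->
     forall k, (k + n < s)%N -> exists i j : 'I_n.+1, exists c : R,
     [/\ i != j, (a i < +oo)%E, (a j < +oo)%E,
         height a beta mu i + y (k + i)%N = c &
         height a beta mu j + y (k + j)%N = c /\
         forall l, (a l < +oo)%E -> c <= height a beta mu l + y (k + l)%N]) ->
  (#|F| <= dseq a s)%N.
Proof.
move=> aok Dy; apply: (free_coords_pdim _ F (\row_m (y0 m - beta * (val m)%:R))).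
move=> z zF zfree; apply: (in_Dset a beta mu _ _ (fun m => zc z m + beta * m%:R) aok).
  by move=> m; rewrite (zcE _ _ (ltn_ord m)) addrK; congr (z _ _); apply: val_inj.
have zcm (m : 'I_s) : zc z m = z ord0 m.
  by rewrite (zcE _ _ (ltn_ord m)); congr (z _ _); apply: val_inj.
apply: (Dy (fun m => zc z m + beta * m%:R)) => m mF /=; first by rewrite zcm zF // mxE subrK.
by have := zfree m mF; rewrite zcm mxE opprB addrA.
Qed.

(** * Two constructions of free coordinates *)

Lemma three_tight_dseq {R : realType} {n : nat} (a : 'I_n.+1 -> \bar R)
    (beta mu : R) (i0 i1 i2 : 'I_n.+1) (s : nat) :
  entries_ok a -> supports a beta mu ->
  (a i0 < +oo)%E -> (a i1 < +oo)%E -> (a i2 < +oo)%E ->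
  height a beta mu i0 = 0 -> height a beta mu i1 = 0 -> height a beta mu i2 = 0 ->
  i0 != i1 -> i0 != i2 -> i1 != i2 ->
  (s <= 4 * dseq a s)%N.
Proof.
move=> aok sup a0 a1 a2 h0 h1 h2 n01 n02 n12.
(* One of the truncated differences is 0, so this is the absolute difference. *)
pose dist (i j : 'I_n.+1) := ((i - j) + (j - i))%N.
(* Where m is too small, truncation makes 0 a neighbour of m, a harmless extra constraint. *)
pose N m := [:: m - dist i0 i1; m - dist i0 i2; m - dist i1 i2]%N.
have [chi chiP] := greedy_coloring 3 N (fun=> leqnn 3) s.
have [x sx] := largest_fiber ord0 (fun m : 'I_s => chi m).
apply: leq_trans sx _; rewrite card_ord leq_mul2l /=.
set F := [set m | _]%SET.
have chiN k (i j : 'I_n.+1) : (k + n < s)%N -> i != j ->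
    (forall m, (m - dist i j)%N \in N m) -> chi (k + i)%N != chi (k + j)%N.
  move=> kns; rewrite neq_ltn => /orP[] /= ij ijN.
    apply: chiP; first by have := ltn_ord j; lia.
      by have -> : (k + i = k + j - dist i j)%N by rewrite /dist; lia.
    by rewrite ltn_add2l.
  rewrite eq_sym; apply: chiP; first by have := ltn_ord i; lia.
    by have -> : (k + j = k + i - dist i j)%N by rewrite /dist; lia.
  by rewrite ltn_add2l.
(* The base level 1 on the colour [x] stays positive under perturbations smaller than 1. *)
apply: (free_levels_dseq a beta mu s (fun m => (chi m == x)%:R) F aok).
move=> y yN yF k kns.
have ks (i : 'I_n.+1) : (k + i < s)%N by have := ltn_ord i; lia.
have y0 (i : 'I_n.+1) : chi (k + i)%N != x -> y (k + i)%N = 0.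
  move=> cx; rewrite (yN (Ordinal (ks i))) /=; last by rewrite inE.
  by rewrite (negPf cx).
have yge0 (i : 'I_n.+1) : 0 <= y (k + i)%N.
  have [cx|cx] := eqVneq (chi (k + i)%N) x; last by rewrite y0.
  have /= := yF (Ordinal (ks i)); rewrite inE /= cx eqxx => /(_ isT).
  by rewrite /= ltr_norml => /andP[]; lra.
have lowP (i j : 'I_n.+1) : (a i < +oo)%E -> (a j < +oo)%E -> i != j ->
    height a beta mu i = 0 -> height a beta mu j = 0 ->
    chi (k + i)%N != x -> chi (k + j)%N != x ->
    exists i j : 'I_n.+1, exists c : R,
     [/\ i != j, (a i < +oo)%E, (a j < +oo)%E,
         height a beta mu i + y (k + i)%N = c &
         height a beta mu j + y (k + j)%N = c /\
         forall l, (a l < +oo)%E -> c <= height a beta mu l + y (k + l)%N].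
  move=> ai aj ij hi hj ci cj; exists i, j, 0; split=> //.
    by rewrite hi y0 // addr0.
  by rewrite hj y0 // addr0; split=> // l al; rewrite addr_ge0 ?sup.
have c01 : chi (k + i0)%N != chi (k + i1)%N.
  by apply: chiN => // m; rewrite !inE eqxx.
have c02 : chi (k + i0)%N != chi (k + i2)%N.
  by apply: chiN => // m; rewrite !inE eqxx orbT.
have c12 : chi (k + i1)%N != chi (k + i2)%N.
  by apply: chiN => // m; rewrite !inE eqxx !orbT.
(* At most one of the three tight positions has the colour [x]; the other two attain the minimum
   0. *)
have [x0|x0] := eqVneq (chi (k + i0)%N) x.
  by apply: (lowP i1 i2) => //; rewrite -x0 eq_sym.
have [x1|x1] := eqVneq (chi (k + i1)%N) x.
  by apply: (lowP i0 i2) => //; rewrite -x1 eq_sym.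
exact: (lowP i0 i1).
Qed.

Lemma incongruent_dseq {R : realType} {n : nat} (a : 'I_n.+1 -> \bar R)
    (beta mu : R) (i0 i1 i2 : 'I_n.+1) (s : nat) :
  entries_ok a -> supports a beta mu ->
  (a i0 < +oo)%E -> (a i1 < +oo)%E -> (a i2 < +oo)%E ->
  height a beta mu i0 = 0 -> height a beta mu i2 = 0 ->
  (i0 < i2)%N -> (i1 != i0 %[mod i2 - i0])%N ->
  (s <= 6 * dseq a s)%N.
Proof.
move=> aok sup a0 a1 a2 h0 h2 lt02 n10.
set q := (i2 - i0)%N in n10 *; have q0 : (0 < q)%N by rewrite subn_gt0.
wlog min1 : i1 a1 n10 / forall l, (a l < +oo)%E -> (l != i0 %[mod q])%N ->
    height a beta mu i1 <= height a beta mu l.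
  move=> main; pose P (l : 'I_n.+1) := (a l < +oo)%E && (l != i0 %[mod q])%N.
  have P1 : P i1 by rewrite /P a1.
  have [i /andP[ai ni] imin] :=
    @Order.TotalTheory.arg_minP _ _ _ i1 P (height a beta mu) P1.
  by apply: (main i) => // l al nl; apply: imin; rewrite /P al.
set c := height a beta mu i1 in min1.
have c0 : 0 <= c by exact: sup.
(* [i1 + i0 (q - 1)] stands for [i1 - i0] modulo [q], without truncation. *)
pose N r := [:: (r + (i1 + i0 * q.-1)) %% q; (r + (i0 + i1 * q.-1)) %% q]%N.
(* Either of the residues of k + i0 and k + i1 may be the larger one, so each residue has two
   neighbours and three colours are needed. *)
have [chi chiP] := greedy_coloring 2 N (fun=> leqnn 2) q.
have chi01 k : chi ((k + i0) %% q)%N != chi ((k + i1) %% q)%N.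
  have shift (u v : nat) : ((k + u) %% q + (v + u * q.-1) = k + v %[mod q])%N.
    rewrite modnDml; have -> : (k + u + (v + u * q.-1) = k + v + u * q)%N.
      by rewrite -{2}(prednK q0) mulnS; lia.
    by rewrite addnC modnMDl.
  have ne : ((k + i1) %% q != (k + i0) %% q)%N by rewrite eqn_modDl.
  move: (ne); rewrite neq_ltn => /orP[] lt.
    rewrite eq_sym; apply: chiP => //; first by rewrite ltn_mod.
    by rewrite !inE shift eqxx.
  apply: chiP => //; first by rewrite ltn_mod.
  by rewrite !inE shift eqxx orbT.
pose high m := chi (m %% q)%N.
(* Three colours times two parities of [m %/ q] give the factor 6; [x] becomes the high colour and
   [b] the parity of the free coordinates. *)
have [[x b] sx] := largest_fiber (ord0, true)
  (fun m : 'I_s => (high m, odd (m %/ q))).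
apply: leq_trans sx _; rewrite card_prod card_ord card_bool leq_mul2l /=.
set F := [set m | _]%SET.
(* High coordinates are based at c + 1 when free and at c otherwise, so perturbations smaller than 1
   keep them at least c. *)
apply: (free_levels_dseq a beta mu s
  (fun m => if high m == x then c + (odd (m %/ q) == b)%:R else 0) F aok).
move=> y yN yF k kns.
have ks (i : 'I_n.+1) : (k + i < s)%N by have := ltn_ord i; lia.
have ylow (i : 'I_n.+1) : high (k + i)%N != x -> y (k + i)%N = 0.
  move=> cx; rewrite (yN (Ordinal (ks i))) /= ?(negPf cx) //.
  by rewrite inE xpair_eqE (negPf cx).
have yhigh (i : 'I_n.+1) : high (k + i)%N == x -> odd ((k + i) %/ q) != b ->
    y (k + i)%N = c.
  move=> cx pb; rewrite (yN (Ordinal (ks i))) /= ?cx ?(negPf pb) ?addr0 //.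
  by rewrite inE xpair_eqE (negPf pb) andbF.
have yge (i : 'I_n.+1) : high (k + i)%N == x -> c <= y (k + i)%N.
  move=> cx; have [pb|pb] := boolP (odd ((k + i) %/ q) == b); last first.
    by rewrite yhigh.
  have /= := yF (Ordinal (ks i)); rewrite inE /= xpair_eqE cx pb => /(_ isT).
  by rewrite /= ltr_norml => /andP[]; lra.
have yge0 (i : 'I_n.+1) : 0 <= y (k + i)%N.
  have [cx|cx] := boolP (high (k + i)%N == x); last by rewrite ylow.
  exact: le_trans (yge _ cx).
have i2E : (i2 = i0 + q :> nat)%N by rewrite /q subnKC // ltnW.
have k20 : (k + i2 = k + i0 + q)%N by rewrite i2E addnA.
have high20 : high (k + i2)%N = high (k + i0)%N by rewrite /high k20 modnDr.
have n02 : i0 != i2 by rewrite neq_ltn lt02.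
have [x0|x0] := boolP (high (k + i0)%N == x); last first.
  exists i0, i2, 0; split=> //; first by rewrite h0 ylow // addr0.
  rewrite h2 ylow ?high20 // addr0; split=> // l al.
  by rewrite addr_ge0 ?sup.
have x1 : high (k + i1)%N != x by rewrite -(eqP x0) eq_sym chi01.
(* An index congruent to [i0] is high here, so its [y] is at least c; any other has height at least
   c by the choice of [i1]. *)
have cmin l : (a l < +oo)%E -> c <= height a beta mu l + y (k + l)%N.
  move=> al; have [l0|l0] := boolP (l == i0 %[mod q])%N.
    rewrite -[c]add0r lerD ?sup // yge // -(eqP x0) /high.
    by rewrite -modnDmr (eqP l0) modnDmr.
  by rewrite -[c]addr0 lerD // min1.
(* The positions k + i0 and k + i2 differ by q, so their parities are opposite and exactly one of
   them is pinned at c. *)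
have [p0|p0] := boolP (odd ((k + i0) %/ q) == b).
  have p2 : odd ((k + i2) %/ q) != b.
    by rewrite k20 divnDr // divnn q0 addn1 /= -(eqP p0); case: (odd _).
  exists i1, i2, c; split=> //; first by apply: contraNneq n10 => ->; rewrite i2E modnDr.
    by rewrite ylow // addr0.
  by rewrite h2 add0r yhigh // high20.
exists i1, i0, c; split=> //; first by apply: contraNneq n10 => ->.
  by rewrite ylow // addr0.
by rewrite h0 add0r yhigh.
Qed.

(** * Vertices of the Newton polygon *)

(** The height of a convex combination over the line is the weighted sum of nonnegative heights. If
    it vanishes, only tight indices carry weight, and these lie on the side of [e] given by [sg]. *)
Lemma newton_polygon_above {R : realType} {n : nat} (a : 'I_n.+1 -> \bar R)
    (beta mu sg : R) (e : nat) (p : R * R) :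
  entries_ok a -> supports a beta mu ->
  (forall j, (a j < +oo)%E -> height a beta mu j = 0 ->
     0 <= sg * ((val j)%:R - e%:R)) ->
  newton_polygon a p ->
  0 <= p.2 - (beta * p.1 + mu) /\
  (p.2 - (beta * p.1 + mu) = 0 -> 0 <= sg * (p.1 - e%:R)).
Proof.
move=> aok sup side [lam [b [lam0 [lam1 [lamb ->]]]]] /=.
pose g i := lam i * (b i - (beta * (val i)%:R + mu)).
have -> : \sum_(i < n.+1) lam i * b i -
    (beta * (\sum_(i < n.+1) lam i * (val i)%:R) + mu) = \sum_i g i.
  have muE : mu = \sum_i lam i * mu by rewrite -mulr_suml lam1 mul1r.
  rewrite [mu in LHS]muE mulr_sumr -big_split /= -sumrB.
  by apply: eq_bigr => i _; rewrite /g /=; ring.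
have above i : 0 < lam i ->
    (a i < +oo)%E /\ height a beta mu i <= b i - (beta * (val i)%:R + mu).
  move=> /lamb abi; have ai : (a i < +oo)%E by rewrite (le_lt_trans abi) ?ltry.
  split=> //; rewrite lerD2r -lee_fin fineK // fin_numE aok -ltey //.
have g0 i : 0 <= g i.
  have := lam0 i; rewrite le_eqVlt => /predU1P[l0|l0].
    by rewrite /g -l0 mul0r.
  have [ai hb] := above i l0; rewrite mulr_ge0 // (le_trans _ hb) //; exact: sup.
split=> [|gs0]; first exact: sumr_ge0.
have g_eq0 i : g i = 0 by apply: (psumr_eq0P _ gs0).
have -> : e%:R = \sum_i lam i * e%:R :> R by rewrite -mulr_suml lam1 mul1r.
rewrite -sumrB mulr_sumr; apply: sumr_ge0 => i _; rewrite -mulrBr mulrCA.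
have := lam0 i; rewrite le_eqVlt => /predU1P[<-|l0]; first by rewrite mul0r.
have [ai hb] := above i l0; rewrite mulr_ge0 // side //.
apply/eqP; rewrite eq_le sup // andbT (le_trans hb) //.
by move/eqP: (g_eq0 i); rewrite mulf_eq0 gt_eqF //= => /eqP ->.
Qed.

(* On the line that supports [a] at [e], the polygon lies on one side of [e]; the
   sign of [sg] says which. *)
Lemma is_vertex_newton {R : realType} {n : nat} (a : 'I_n.+1 -> \bar R)
    (beta mu sg : R) (e : 'I_n.+1) :
  entries_ok a -> supports a beta mu -> (a e < +oo)%E ->
  height a beta mu e = 0 -> sg != 0 ->
  (forall j, (a j < +oo)%E -> height a beta mu j = 0 ->
     0 <= sg * ((val j)%:R - (val e)%:R)) ->
  is_vertex (newton_polygon a) ((val e)%:R, fine (a e)).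
Proof.
move=> aok sup ae he sg0 side; split.
  exists (fun i => (i == e)%:R), (fun=> fine (a e)); split=> //.
  have sume (c : 'I_n.+1 -> R) : \sum_i (i == e)%:R * c i = c e.
    rewrite (bigD1 e) //= big1 ?eqxx ?mul1r ?addr0 // => i /negPf ->.
    by rewrite mul0r.
  split; first by rewrite -[RHS](sume (fun=> 1)); apply: eq_bigr => i _; rewrite mulr1.
  split; last by rewrite !sume.
  move=> i; have [-> _|_] := eqVneq i e; last by rewrite ltxx.
  by rewrite fineK // fin_numE aok -ltey.
move=> [qx qy] [rx ry] t Pq Pr /andP[t0 t1] /= [px py].
have [/= q0 qs] := newton_polygon_above a beta mu sg e _ aok sup side Pq.
have [/= r0 rs] := newton_polygon_above a beta mu sg e _ aok sup side Pr.
have t1' : 0 < 1 - t by rewrite subr_gt0.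
have [t_ge0 t1_ge0] := (ltW t0, ltW t1').
(* The heights of both points are nonnegative and average to 0, so both vanish; the same argument
   then applies to the signed horizontal offsets from [e]. *)
have g0 : t * (qy - (beta * qx + mu)) + (1 - t) * (ry - (beta * rx + mu)) = 0.
  by rewrite -he /height px py; ring.
move/eqP: g0; rewrite paddr_eq0 ?mulr_ge0 //.
rewrite !mulf_eq0 (gt_eqF t0) (gt_eqF t1') /= => /andP[/eqP gq /eqP gr].
have x0 : t * (sg * (qx - (val e)%:R)) + (1 - t) * (sg * (rx - (val e)%:R)) = 0.
  by rewrite px; ring.
move/eqP: x0; rewrite paddr_eq0 ?(mulr_ge0 t_ge0 (qs gq)) ?(mulr_ge0 t1_ge0 (rs gr)) //.
rewrite !mulf_eq0 (gt_eqF t0) (gt_eqF t1') (negPf sg0) /= !subr_eq0.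
move=> /andP[/eqP qe /eqP re]; move: gq gr he; rewrite qe re /height.
by move=> gq gr he; split; congr pair; lra.
Qed.

(** * Hull edges and regularity *)

(** Any two points on a supporting line qualify, not only the ends of a full edge of the lower
    hull. *)
Definition hull_edge {R : realType} {n : nat} (a : 'I_n.+1 -> \bar R)
    (beta mu : R) (v w : 'I_n.+1) : Prop :=
  [/\ supports a beta mu, (a v < +oo)%E /\ (a w < +oo)%E,
      height a beta mu v = 0, height a beta mu w = 0 & (v < w)%N].

(* Of all slopes from [v] to the right the least one bounds an edge: a line that
   supports [a] at [v] has at most this slope, so that the points on the left of
   [v] stay above. *)
Lemma next_hull_edge {R : realType} {n : nat} (a : 'I_n.+1 -> \bar R)
    (v : 'I_n.+1) :
  (a v < +oo)%E -> (exists2 j : 'I_n.+1, (v < j)%N & (a j < +oo)%E) ->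
  (v = ord0 \/ exists beta mu, supports a beta mu /\ height a beta mu v = 0) ->
  exists beta mu w, hull_edge a beta mu v w.
Proof.
move=> av [j0 vj0 aj0] left_v.
pose P (j : 'I_n.+1) := (v < j)%N && (a j < +oo)%E.
pose slope (j : 'I_n.+1) := (fine (a j) - fine (a v)) / ((val j)%:R - (val v)%:R).
have P0 : P j0 by rewrite /P vj0.
have [w /andP[vw aw] wmin] := @Order.TotalTheory.arg_minP _ _ _ j0 P slope P0.
pose beta := slope w; pose mu := fine (a v) - beta * (val v)%:R.
have hE j : height a beta mu j =
    fine (a j) - fine (a v) - beta * ((val j)%:R - (val v)%:R).
  by rewrite /height /mu; ring.
have gapP (j : 'I_n.+1) : (v < j)%N -> 0 < (val j)%:R - (val v)%:R :> R.
  by move=> vj; rewrite subr_gt0 ltr_nat.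
exists beta, mu, w; split=> //.
- move=> j aj; rewrite hE; have [jv|vj|/val_inj ->] := ltngtP j v.
  + case: left_v => [v0|[beta0 [mu0 [sup hv]]]]; first by move: jv; rewrite v0.
    have jv0 : 0 < (val v)%:R - (val j)%:R :> R by rewrite subr_gt0 ltr_nat.
    have bb : beta0 <= beta.
      rewrite /beta /slope ler_pdivlMr ?gapP //.
      by have := sup w aw; move: hv; rewrite /height; lra.
    have := sup j aj; move: hv; rewrite /height; nra.
  + rewrite subr_ge0 -ler_pdivlMr ?gapP //; apply: wmin.
    by rewrite /P vj.
  + by rewrite !subrr mulr0 subrr.
- by rewrite hE !subrr mulr0 subrr.
- by rewrite hE /beta /slope divfK ?subrr // gt_eqF ?gapP.
Qed.

(** The hull is walked from left to right. The first edge starts at 0, and its length q divides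
    every index of the support; each later edge turns out to have length q as well, so the support
    consists of all multiples of q up to n. *)
Lemma regular_of_hull_edges {R : realType} {n : nat} (a : 'I_n.+1 -> \bar R) :
  (1 <= n)%N -> entries_ok a -> (a ord0 < +oo)%E -> (a ord_max < +oo)%E ->
  (forall beta mu v w, hull_edge a beta mu v w -> forall i, (a i < +oo)%E ->
     (height a beta mu i = 0 -> i = v \/ i = w) /\ (i == v %[mod w - v])%N) ->
  regular a.
Proof.
move=> n1 aok a0 an edgeP.
have [|beta0 [mu0 [w0 edge0]]] :=
    next_hull_edge a ord0 a0 _ (or_introl (erefl _)).
  by exists ord_max.
have [_ [_ aw0] _ _ w0_gt0] := edge0; rewrite /= in w0_gt0.
pose q := nat_of_ord w0.
have qdvd (i : 'I_n.+1) : (a i < +oo)%E -> (q %| i)%N.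
  by move=> ai; have [_] := edgeP _ _ _ _ edge0 i ai; rewrite /= subn0 mod0n.
have chain t : (t * q <= n)%N -> exists2 v : 'I_n.+1, val v = (t * q)%N &
    (a v < +oo)%E /\ (v = ord0 \/ exists beta mu u, hull_edge a beta mu u v).
  elim: t => [_|t IHt tn]; first by exists ord0; split=> //; left.
  have [|v vE [av left_v]] := IHt.
    by apply: leq_trans tn; rewrite leq_mul2r leqnSn orbT.
  have [||beta [mu [w edge]]] := next_hull_edge a v av.
  - exists ord_max => //=; rewrite -[X in (X < _)%N]/(val v) vE.
    by apply: leq_trans tn; rewrite mulSn -[X in (X < _)%N]add0n ltn_add2r.
  - case: left_v => [|[beta [mu [u [sup _ _ hv _]]]]]; first by left.
    by right; exists beta, mu.
  have [_ [_ aw] _ _ vw] := edge.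
  (* Both ends are multiples of q. Conversely, 0 and [w0] are congruent to [v] modulo w - v, so this
     length divides q. *)
  have vw_q : (w - v)%N = q.
    apply/eqP; rewrite eqn_dvd; apply/andP; split; last by rewrite dvdn_sub ?qdvd.
    have [_ c0] := edgeP _ _ _ _ edge _ a0.
    have [_ cq] := edgeP _ _ _ _ edge _ aw0.
    have : (w0 == 0 %[mod w - v])%N by rewrite (eqP cq) -(eqP c0).
    by rewrite mod0n.
  exists w; last by split=> //; right; exists beta, mu, v.
  by rewrite mulSn -vE -vw_q subnK // ltnW.
split.
  exists 0%N, q, (n %/ q)%N; split=> // i; split.
    move=> [j [<- aj]]; exists (j %/ q)%N; last by rewrite add0n divnK // qdvd.
    by apply: leq_div2r; rewrite -ltnS.
  move=> [t tn ->]; have [|v vE [av _]] := chain t; last by exists v.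
  by apply: leq_trans (leq_trunc_div n q); rewrite leq_mul2r tn orbT.
move=> i ai aiE; have afin : (a i < +oo)%E by rewrite aiE ltry.
have -> : ai = fine (a i) by rewrite aiE.
have [|v vE [_ left_v]] := chain (i %/ q)%N.
  by rewrite divnK ?qdvd // -ltnS.
have {vE} vi : v = i by apply: val_inj; rewrite vE divnK ?qdvd.
(* The index 0 is the left end of the first edge, hence sign 1; any other index is the right end of
   the edge that reached it, hence sign -1. *)
rewrite {}vi in left_v; case: left_v => [v0|[beta [mu [u edge]]]].
  have [sup _ h0 _ _] := edge0.
  apply: (is_vertex_newton a beta0 mu0 1 i) => //; rewrite ?v0 ?oner_eq0 //.
  by move=> j _ _; rewrite mul1r subr0 ler0n.
have [sup _ _ hi ui] := edge.
apply: (is_vertex_newton a beta mu (-1) i) => //.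
move=> j aj hj; rewrite mulN1r opprB subr_ge0 ler_nat.
by have [/(_ hj)[]-> _] := edgeP _ _ _ _ edge j aj; rewrite // ltnW.
Qed.

(** * The entropy bound *)

Lemma dseq_ge {R : realType} {n : nat} (a : 'I_n.+1 -> \bar R) (s : nat) :
  (1 <= n)%N -> entries_ok a -> (a ord0 < +oo)%E -> (a ord_max < +oo)%E ->
  ~ regular a -> (s <= 6 * dseq a s)%N.
Proof.
move=> n1 aok a0 an nreg; apply: contrapT => small; apply: nreg.
apply: regular_of_hull_edges => // beta mu v w [sup [av aw] hv hw vw] i ai; split.
  move=> hi; apply: contrapT => ivw; apply: small.
  have iv : i != v by apply/eqP => iv; apply: ivw; left.
  have iw : i != w by apply/eqP => iw; apply: ivw; right.
  have vw' : v != w by rewrite neq_ltn vw.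
  apply: (leq_trans (three_tight_dseq a beta mu i v w s aok sup _ _ _ _ _ _ _ _ _))
    => //.
  by rewrite leq_mul2r orbT.
apply: contrapT => /negP ni; apply: small.
exact: (incongruent_dseq a beta mu v i w).
Qed.

(* H(a) = lim_{s -> oo} d_s / s exists and is >= 1/6. *)
Theorem theorem3 (R : realType) (n : nat) (a : 'I_n.+1 -> \bar R) :
  (1 <= n)%N ->
  entries_ok a ->
  (a ord0 < +oo)%E -> (a ord_max < +oo)%E ->
  ~ regular a ->
  exists2 H : R,
    (fun s : nat => ((dseq a s)%:R / s%:R : R)) @ \oo --> H & 1 / 6 <= H.
Proof.
move=> n1 aok a0 an nreg; eexists.
  by apply: fekete => [s t|s]; [exact: dseq_subadditive | exact: pdim_le].
apply: lb_le_inf; first by exists ((dseq a 1)%:R / 1%:R), 1%N.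
move=> _ [s /= s0 <-]; rewrite ler_pdivlMr ?ltr0n //.
have := dseq_ge a s n1 aok a0 an nreg; rewrite -(ler_nat R) natrM.
lra.
Qed.
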